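(* For all integers $n \geq 1$, $$p_{3,3}(n) \equiv \begin{cases} 1 \pmod{2}, & \text{if } 3n+1 \text{ is a perfect square}, \\ 0 \pmod{2}, & \text{otherwise.} \end{cases}$$
   Context: For positive integers $A, a$ and an integer partition $\lambda$, $\mathrm{mex}_{A,a}(\lambda)$ denotes the smallest positive integer congruent to $a$ modulo $A$ that is not a part of $\lambda$. For $n \geq 0$, $p_{A,a}(n)$ denotes the number of partitions $\lambda$ of $n$ satisfying $\mathrm{mex}_{A,a}(\lambda) \equiv a \pmod{2A}$. In particular, $p_{3,3}(n)$ is the number of partitions $\lambda$ of $n$ whose smallest positive multiple of $3$ that is not a part is congruent to $3$ modulo $6$. *)

(* Defs.v *)
From mathcomp Require Import all_boot.

Set Implicit Arguments.
Unset Strict Implicit.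
Unset Printing Implicit Defensive.

Definition is_intpart (n : nat) (s : seq nat) : bool :=
  [&& sorted geq s, all (leq 1) s & sumn s == n].

(* A partition of n has at most n parts, each at most n, so it is the image of
   a unique element of the finite type n.-bseq 'I_n.+1; see intpart_seqP and
   intpart_seq_inj. *)
Definition intpart_seq (n : nat) (l : n.-bseq 'I_n.+1) : seq nat :=
  [seq val i | i <- l].

Definition intparts (n : nat) : {set n.-bseq 'I_n.+1} :=
  [set l | is_intpart n (intpart_seq l)].

Lemma intpart_seq_inj (n : nat) : injective (@intpart_seq n).
Proof. by move=> l1 l2 /(inj_map val_inj) /val_inj. Qed.

Lemma intpart_seqP (n : nat) (s : seq nat) :
  reflect (exists2 l, l \in intparts n & intpart_seq l = s) (is_intpart n s).
Proof.
apply: (iffP idP) => [part_s | [l + <-]]; last by rewrite inE.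
have /and3P[_ s_gt0 /eqP sum_s] := part_s.
have size_s : size s <= n.
  rewrite -sum_s; elim: s s_gt0 {part_s sum_s} => //= x s IHs /andP[x_gt0 s_gt0].
  by rewrite -add1n leq_add ?IHs.
have s_le_n x : x \in s -> x < n.+1.
  by move=> sx; rewrite ltnS -sum_s (perm_sumn (perm_to_rem sx)) leq_addr.
have size_l : size [seq inord x : 'I_n.+1 | x <- s] <= n by rewrite size_map.
have def_s : intpart_seq (Bseq size_l) = s.
  rewrite /intpart_seq /= -map_comp map_id_in // => x /s_le_n x_le_n /=.
  by rewrite inordK.
by exists (Bseq size_l); rewrite ?inE def_s.
Qed.

Definition mex_candidate (A a : nat) (s : seq nat) : pred nat :=
  fun m => [&& 0 < m, m == a %[mod A] & m \notin s].

Lemma mex_candidate_ex (A a : nat) (A_gt0 : 0 < A) (s : seq nat) :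
  exists m, mex_candidate A a s m.
Proof.
exists ((sumn s).+1 * A + a).
have lt_sum : sumn s < (sumn s).+1 * A + a.
  by rewrite ltn_addr // leq_pmulr.
rewrite /mex_candidate modnMDl eqxx (leq_ltn_trans _ lt_sum) //=.
apply/negP => s_m; move: lt_sum.
by rewrite {1}(perm_sumn (perm_to_rem s_m)) /= ltnNge leq_addr.
Qed.

(* A > 0 is what makes the set of candidates nonempty for every s. *)
Definition mex (A a : nat) (A_gt0 : 0 < A) (s : seq nat) : nat :=
  ex_minn (mex_candidate_ex a A_gt0 s).
Arguments mex A a A_gt0 s : clear implicits.

Definition mex_count (A a : nat) (A_gt0 : 0 < A) (n : nat) : nat :=
  #|[set l in intparts n | mex A a A_gt0 (intpart_seq l) == a %[mod 2 * A]]|.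
Arguments mex_count A a A_gt0 n : clear implicits.

Definition perfect_square (m : nat) : Prop := exists k : nat, m = k ^ 2.

(* Main.v *)
Require Import Defs.
From mathcomp Require Import all_boot all_order all_algebra.
From mathcomp Require Import zify ring.
From Stdlib Require Import Setoid Morphisms.

Set Implicit Arguments.
Unset Strict Implicit.
Unset Printing Implicit Defensive.

Import GRing.Theory.
Local Open Scope ring_scope.

(** Write [T_j] for the triangular number [j (j + 1) / 2], and let [3 k] be the
    least multiple of 3 missing from a partition [s].  The multiples
    [3, 6, .., 3 j] are all parts of [s] exactly when [j < k], so [k] counts
    these [j]; modulo 2, the number of partitions of [n] with [k] odd is
    therefore the sum over [j] of the number of partitions of [n] containing
    [3, 6, .., 3 j].  Hence its generating function [W] satisfies
[[
      W * E(q) = \sum_(j >= 0) q ^ (3 T_j),   E(q) = \prod_(i > 0) (1 - q ^ i)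
]]
    over the field with two elements ([mex_count_generating_function]).

    Both this right-hand side and
    [Theta = \sum_(k in Z) q ^ (3 k ^ 2 + 2 k)] are given by the Jacobi triple
    product ([jacobi_triple_product]), respectively with [(a, b) = (3, 9)] and
    [(a, b) = (1, 5)].  In characteristic 2 one has [E(q ^ 2) = E(q) ^ 2], and
    the product [O(q)] of the [1 + q ^ i] over odd [i] satisfies
    [O(q) E(q ^ 2) = E(q)], so that [O(q) E(q) = 1]
    ([odd_product_inverse]).  Then
    -  the (3, 9) product is [E(q ^ 12) O(q ^ 3) = E(q ^ 3) ^ 3]
       ([psi3_cube]);
    -  the (1, 5) product is [E(q ^ 6) O(q) / O(q ^ 3) = E(q ^ 3) ^ 3 / E(q)],
       because the numbers prime to 6 are the odd numbers that are not odd
       multiples of 3 ([theta_times_euler]).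

    So [W * E = Theta * E], and [W = Theta] since [E] has constant term 1.  The
    theorem follows because [3 n + 1 = (3 k + 1) ^ 2] is equivalent to
    [n = 3 k ^ 2 + 2 k], and every square of the form [3 n + 1] is
    [(3 k + 1) ^ 2] for exactly one integer [k].

    Power series are replaced by polynomials modulo [X ^ N], and infinite sums
    and products by their first [N] terms, or more: the exponent of [X] attached
    to an index [i] is always at least [i], so that nothing beyond these terms
    is visible modulo [X ^ N]. *)

(** * Congruence of polynomials modulo a power of the variable *)

Definition eqX (F : fieldType) (N : nat) (p q : {poly F}) : Prop :=
  'X^N %| p - q.

Section Truncation.

Variables (F : fieldType) (N : nat).
Implicit Types p q r s : {poly F}.

Lemma eqX_refl p : eqX N p p.
Proof. by rewrite /eqX subrr dvdp0. Qed.

Lemma eqX_sym p q : eqX N p q -> eqX N q p.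
Proof. by rewrite /eqX -opprB dvdpNr. Qed.

Lemma eqX_trans q p r : eqX N p q -> eqX N q r -> eqX N p r.
Proof. by rewrite /eqX => pq qr; rewrite -(subrKA q) dvdp_add. Qed.

Lemma eqXD p q r s : eqX N p q -> eqX N r s -> eqX N (p + r) (q + s).
Proof. by rewrite /eqX => pq rs; rewrite opprD addrACA dvdp_add. Qed.

Lemma eqXM p q r s : eqX N p q -> eqX N r s -> eqX N (p * r) (q * s).
Proof.
rewrite /eqX => pq rs.
have -> : p * r - q * s = (p - q) * r + q * (r - s) by ring.
by apply: dvdp_add; [exact: dvdp_mulr | exact: dvdp_mull].
Qed.

Lemma eqX_sum (I : Type) (r : seq I) (P : pred I) (f g : I -> {poly F}) :
  (forall i, P i -> eqX N (f i) (g i)) ->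
  eqX N (\sum_(i <- r | P i) f i) (\sum_(i <- r | P i) g i).
Proof.
move=> fg; apply: (big_ind2 (@eqX F N)) => //.
- exact: eqX_refl.
- exact: eqXD.
Qed.

Lemma eqX_prod (I : Type) (r : seq I) (P : pred I) (f g : I -> {poly F}) :
  (forall i, P i -> eqX N (f i) (g i)) ->
  eqX N (\prod_(i <- r | P i) f i) (\prod_(i <- r | P i) g i).
Proof.
move=> fg; apply: (big_ind2 (@eqX F N)) => //.
- exact: eqX_refl.
- exact: eqXM.
Qed.

Lemma eqX_coef p q i : eqX N p q -> (i < N)%N -> p`_i = q`_i.
Proof.
case/dvdpP=> u pq i_lt; apply/eqP; rewrite -subr_eq0 -coefB pq coefMXn i_lt.
by [].
Qed.

Lemma eqX_Xn e : (N <= e)%N -> eqX N ('X^e : {poly F}) 0.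
Proof. by rewrite /eqX subr0 => ?; rewrite dvdp_exp2l. Qed.

(** A constant term 1 makes [d] a unit modulo ['X^N]. *)
Lemma eqX_mul2l (d p q : {poly F}) :
  d`_0 = 1 -> eqX N (d * p) (d * q) -> eqX N p q.
Proof.
move=> d0; rewrite /eqX -mulrBr Gauss_dvdpr //.
rewrite coprimep_expl // coprimep_sym coprimepX; apply/negP => /rootP.
by rewrite horner_coef0 d0; apply/eqP; rewrite oner_eq0.
Qed.

(** The truncated form of convergence of an infinite product: its partial
    products are eventually constant modulo ['X^N]. *)
Lemma eqX_prod_tail (f : nat -> {poly F}) (K : nat) :
  (forall i, (N <= i)%N -> eqX N (f i) 1) -> (N <= K)%N ->
  eqX N (\prod_(i < K) f i) (\prod_(i < N) f i).
Proof.
move=> f1 le_NK; rewrite -(subnKC le_NK) big_split_ord /=.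
rewrite -[X in eqX N _ X]mulr1; apply: eqXM; first exact: eqX_refl.
apply: (@eqX_trans (\prod_(i < K - N) 1)); last by rewrite big1_eq; exact: eqX_refl.
by apply: eqX_prod => i _; apply: f1; apply: leq_addr.
Qed.

Lemma eqX_sum_tail (f : nat -> {poly F}) (K : nat) :
  (forall i, (N <= i)%N -> eqX N (f i) 0) -> (N <= K)%N ->
  eqX N (\sum_(i < K) f i) (\sum_(i < N) f i).
Proof.
move=> f0 le_NK; rewrite -(subnKC le_NK) big_split_ord /=.
rewrite -[X in eqX N _ X]addr0; apply: eqXD; first exact: eqX_refl.
apply: (@eqX_trans (\sum_(i < K - N) 0)); last by rewrite big1_eq; exact: eqX_refl.
by apply: eqX_sum => i _; apply: f0; apply: leq_addr.
Qed.

End Truncation.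

#[local] Hint Resolve eqX_refl : core.

#[local] Instance eqX_equivalence F N : Equivalence (@eqX F N).
Proof.
split; [exact: eqX_refl | exact: eqX_sym | move=> p q r; exact: eqX_trans].
Qed.

#[local] Instance eqX_mul_proper (F : fieldType) N :
  Proper (@eqX F N ==> @eqX F N ==> @eqX F N) *%R.
Proof. by move=> p q pq r s rs; apply: eqXM. Qed.

#[local] Instance eqX_add_proper (F : fieldType) N :
  Proper (@eqX F N ==> @eqX F N ==> @eqX F N) +%R.
Proof. by move=> p q pq r s rs; apply: eqXD. Qed.

(** * The Jacobi triple product *)

Section GaussianBinomial.

Variables (R : comNzRingType) (q : R).

(** Gaussian binomial coefficients, by the q-analogue of Pascal's rule, which
    avoids any division in [R]. *)
Fixpoint gbinom (n k : nat) : R :=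
  match n, k with
  | _, 0 => 1
  | 0, _.+1 => 0
  | n'.+1, k'.+1 => q ^+ k'.+1 * gbinom n' k'.+1 + gbinom n' k'
  end.

(** The q-Pochhammer symbol [(q; q)_n]. *)
Definition qfact (n : nat) : R := \prod_(i < n) (1 - q ^+ i.+1).

Lemma gbinom_small n k : (n < k)%N -> gbinom n k = 0.
Proof.
elim: n k => [|n IHn] [|k] //= lt_nk.
by rewrite !IHn ?mulr0 ?addr0 //; lia.
Qed.

Lemma gbinom0 n : gbinom n 0 = 1.
Proof. by case: n. Qed.

(** The two terms of Pascal's rule contribute [q^a (1 - q^b)] and [1 - q^a]
    times the same q-factorial, and these add up to [1 - q^(a + b)]. *)
Lemma gbinom_fact a b :
  gbinom (a + b) a * (qfact a * qfact b) = qfact (a + b).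
Proof.
move: {-1}(a + b)%N (erefl (a + b)%N) => n.
elim: n a b => [|n IHn] [|a] [|b] //= def_n.
- by rewrite /qfact !big_ord0 !mulr1.
- by rewrite -def_n /qfact big_ord0 !mul1r.
- have def_a : a = n by lia.
  rewrite gbinom_small ?def_a // mulr0 add0r.
  have := IHn n 0%N (addn0 n); rewrite /qfact !big_ord0 !mulr1 => IH.
  by rewrite big_ord_recr /= mulrA IH.
- have IH1 := IHn a.+1 b ltac:(lia); have IH2 := IHn a b.+1 ltac:(lia).
  have fact_rec k : qfact k.+1 = qfact k * (1 - q ^+ k.+1).
    by rewrite /qfact big_ord_recr.
  have qn : q ^+ n.+1 = q ^+ a.+1 * q ^+ b.+1 by rewrite -exprD; congr (_ ^+ _).
  transitivity (q ^+ a.+1 * (1 - q ^+ b.+1) *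
      (gbinom n a.+1 * (qfact a.+1 * qfact b)) +
    (1 - q ^+ a.+1) * (gbinom n a * (qfact a * qfact b.+1))).
    by rewrite !fact_rec; ring.
  by rewrite IH1 IH2 fact_rec qn; ring.
Qed.

(** The q-binomial theorem.  Peeling off the factor [y + x] replaces [x] by
    [x q] in the others, and comparing coefficients of [x ^+ k] then gives
    Pascal's rule.  The homogeneous form in [x] and [y] lets the triple product
    be derived without negative powers. *)
Lemma qbinomial n x y :
  \prod_(i < n) (y + x * q ^+ i) =
  \sum_(k < n.+1) gbinom n k * q ^+ 'C(k, 2) * x ^+ k * y ^+ (n - k).
Proof.
elim: n x => [|n IHn] x.
  by rewrite big_ord0 big_ord1 /= !mulr1.
rewrite big_ord_recl /= expr0 mulr1.
rewrite (eq_bigr (fun i : 'I_n => y + x * q * q ^+ i)); last first.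
  by move=> i _; rewrite /bump /= exprS mulrA.
rewrite IHn mulrDl [in LHS]mulr_sumr [in RHS]big_ord_recl.
rewrite [X in X + _]big_ord_recl /= !gbinom0 /= -addrA; congr (_ + _).
  by rewrite !expr0 !subn0 exprS; ring.
rewrite -[in RHS](big_mkord xpredT (fun k => gbinom n.+1 k.+1 *
   q ^+ 'C(k.+1, 2) * x ^+ k.+1 * y ^+ (n.+1 - k.+1))) /=.
have tail : \sum_(0 <= k < n.+1) q ^+ k.+1 * gbinom n k.+1 * q ^+ 'C(k.+1, 2)
      * x ^+ k.+1 * y ^+ (n - k) =
    \sum_(i < n) y * (gbinom n (bump 0 i) * q ^+ 'C(bump 0 i, 2) *
      (x * q) ^+ bump 0 i * y ^+ (n - bump 0 i)).
  rewrite big_nat_recr //= gbinom_small // mulr0 !mul0r addr0 big_mkord.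
  apply: eq_bigr => i _; rewrite /bump /= add1n exprMn.
  have -> : (n - i = (n - i.+1).+1)%N by have := ltn_ord i; lia.
  by rewrite [y ^+ _.+1]exprS; ring.
rewrite -tail mulr_sumr !big_mkord -big_split /=.
apply: eq_bigr => k _; rewrite subSS binS bin1 exprMn exprD !exprS.
by ring.
Qed.

End GaussianBinomial.

(** With [Q = X ^ (a + b)] and [z = X ^ a], this is the exponent of [X] in the
    term [z ^ m Q ^ 'C(m, 2)] of the Jacobi theta series.  The term of index
    [- r] has exponent [theta_exp b a r], which is how the part of the series
    with negative indices is expressed. *)
Definition theta_exp (a b m : nat) : nat := (a * m + (a + b) * 'C(m, 2))%N.

Lemma bin2D k m : 'C(k + m, 2) = ('C(k, 2) + 'C(m, 2) + k * m)%N.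
Proof. by elim: m => [|m IHm]; rewrite ?addn0 ?addnS ?binS ?bin1 ?IHm; lia. Qed.

Lemma bin2_double m : (2 * 'C(m, 2) + m = m * m)%N.
Proof. by elim: m => // m IHm; rewrite binS bin1; lia. Qed.

Section TripleProduct.

Variables (F : fieldType) (a b : nat).
Let s := (a + b)%N.
Let Q : {poly F} := 'X^s.

(** The q-binomial theorem with [2 K] factors, [y = Q ^ K] and [x = X ^ a].  The
    factor [Q ^ K + X ^ a Q ^ i] is divisible by [X ^ a Q ^ i] when [i < K], with
    quotient [1 + X ^ (b + s (K - 1 - i))], and by [Q ^ K] otherwise.  The
    middle index [k = K] becomes the origin of the theta series, once the common
    power of [X] is cancelled. *)
Lemma finite_triple_product K :
  \prod_(j < K) (1 + 'X^(a + s * j)) * \prod_(j < K) (1 + 'X^(b + s * j)) =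
  \sum_(m < K.+1) gbinom Q (K + K) (K + m) * 'X^(theta_exp a b m) +
  \sum_(r < K) gbinom Q (K + K) (K - r.+1) * 'X^(theta_exp b a r.+1)
  :> {poly F}.
Proof.
(* C is the total power of X extracted from the 2 K factors. *)
set C := (a * K + s * 'C(K, 2) + s * K * K)%N.
apply: (@mulfI _ ('X^C : {poly F})); first by rewrite monic_neq0 ?monicXn.
have low : \prod_(j < K) (Q ^+ K + 'X^a * Q ^+ j) =
    'X^(a * K + s * 'C(K, 2)) * \prod_(j < K) (1 + 'X^(b + s * j)).
  rewrite [X in _ * X](reindex_inj rev_ord_inj) /=.
  have -> : (a * K + s * 'C(K, 2) = \sum_(j < K) (a + s * j))%N.
    rewrite big_split /= sum_nat_const card_ord -big_distrr /=.
    by rewrite -(big_mkord xpredT id) bin2_sum mulnC.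
  rewrite expr_sum -big_split /=; apply: eq_bigr => j _.
  rewrite mulrDr mulr1 /Q -!exprM -!exprD addrC; congr (_ + 'X^_).
  by rewrite /s; have := ltn_ord j; nia.
have high : \prod_(j < K) (Q ^+ K + 'X^a * Q ^+ (K + j)) =
    'X^(s * K * K) * \prod_(j < K) (1 + 'X^(a + s * j)).
  have -> : (s * K * K = \sum_(j < K) s * K)%N.
    by rewrite sum_nat_const card_ord mulnC.
  rewrite expr_sum -big_split /=; apply: eq_bigr => j _.
  rewrite mulrDr mulr1 /Q -!exprM -!exprD; congr (_ + 'X^_).
  by lia.
transitivity (\prod_(i < K + K) (Q ^+ K + 'X^a * Q ^+ i)).
  by rewrite big_split_ord /= low high /C !exprD; ring.
rewrite qbinomial -addnS big_split_ord /= addrC mulrDr !mulr_sumr.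
rewrite [X in _ + X](reindex_inj rev_ord_inj) /=.
congr (_ + _); apply: eq_bigr => i _; rewrite /Q -!exprM.
  rewrite [RHS]mulrCA -!mulrA -!exprD; congr (_ * 'X^_).
  have [t def_K] : exists t, K = (t + i)%N
    by exists (K - i)%N; have := ltn_ord i; lia.
  have -> : (K + K - (K + i) = t)%N by lia.
  by rewrite bin2D /C /theta_exp /s; nia.
rewrite [RHS]mulrCA -!mulrA -!exprD; congr (_ * 'X^_).
have lt_i := ltn_ord i; rewrite /C /theta_exp /s.
move: (nat_of_ord i) lt_i => r lt_rK.
have [t def_K] : exists t, K = (t + r.+1)%N by exists (K - r.+1)%N; lia.
have -> : (K - r.+1 = t)%N by lia.
have -> : (K + K - t = K + r.+1)%N by lia.
by rewrite def_K bin2D; have := bin2_double r.+1; nia.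
Qed.

Hypotheses (a_gt0 : (0 < a)%N) (b_gt0 : (0 < b)%N).

Variable N : nat.

Lemma qfact_coef0 k : (qfact Q k)`_0 = 1.
Proof.
rewrite -horner_coef0 horner_prod big1 // => i _.
rewrite /Q -exprM !hornerE expr0n (_ : (s * i.+1 == 0)%N = false) ?subr0 //.
by rewrite /s; lia.
Qed.

Lemma qfact_stable k : (N <= k)%N -> eqX N (qfact Q k) (qfact Q N).
Proof.
move=> le_Nk; apply: (eqX_prod_tail (f := fun i => 1 - Q ^+ i.+1)) => //.
move=> i le_Ni.
rewrite /eqX addrAC subrr sub0r dvdpNr /Q -exprM dvdp_exp2l //.
by rewrite /s; nia.
Qed.

(** The central Gaussian binomials tend to the inverse of the infinite product
    of the [1 - Q ^ i]: all three q-factorials in [gbinom_fact] are that product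
    modulo ['X^N]. *)
Lemma gbinom_stable k l : (N <= k)%N -> (N <= l)%N ->
  eqX N (qfact Q N * gbinom Q (k + l) k) 1.
Proof.
move=> le_Nk le_Nl; apply: (@eqX_mul2l _ _ (qfact Q N)).
  exact: qfact_coef0.
rewrite mulr1 mulrA mulrC.
apply: (@eqX_trans _ _ (qfact Q (k + l))); last first.
  by apply: qfact_stable; rewrite (leq_trans le_Nk) ?leq_addr.
rewrite -gbinom_fact; apply: eqXM; first exact: eqX_refl.
by apply: eqX_sym; apply: eqXM; apply: qfact_stable.
Qed.

(** The limit of [finite_triple_product], taken here with [K = 2 N]: an index at
    distance at most [N] from the middle has both arguments of its Gaussian
    binomial large enough for [gbinom_stable], and the exponent of any other
    index exceeds [N]. *)
Theorem jacobi_triple_product :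
  eqX N (\prod_(j < N) (1 + 'X^(a + s * j)) * \prod_(j < N) (1 + 'X^(b + s * j))
         * \prod_(j < N) (1 - 'X^(s * j.+1)))
    (\sum_(m < N) 'X^(theta_exp a b m) + \sum_(r < N) 'X^(theta_exp b a r.+1)
     : {poly F}).
Proof.
have -> : \prod_(j < N) (1 - 'X^(s * j.+1)) = qfact Q N.
  by apply: eq_bigr => j _; rewrite /Q -exprM.
have le_N2 : (N <= N + N)%N by rewrite leq_addr.
have long c : (0 < c)%N ->
    eqX N (\prod_(j < N + N) (1 + 'X^(c + s * j)))
          (\prod_(j < N) (1 + 'X^(c + s * j)) : {poly F}).
  move=> c_gt0; apply: (eqX_prod_tail (f := fun i => 1 + 'X^(c + s * i))) => //.
  move=> i le_Ni.
  rewrite -[X in eqX N _ X]addr0; apply: eqXD => //.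
  by apply: eqX_Xn; rewrite /s; nia.
rewrite -(long a) // -(long b) //.
rewrite finite_triple_product mulrC mulrDr !mulr_sumr.
apply: eqXD.
  rewrite -(eqX_sum_tail (f := fun m => 'X^(theta_exp a b m)) _ (leqW le_N2));
    last first.
    by move=> i le_Ni; apply: eqX_Xn; rewrite /theta_exp; nia.
  apply: eqX_sum => m _.
  have [le_mN | lt_Nm] := leqP m N; last first.
    rewrite eqX_Xn ?mulr0; first exact: eqX_refl.
    by rewrite /theta_exp; nia.
  rewrite mulrA -[X in eqX N _ X]mul1r; apply: eqXM; last exact: eqX_refl.
  rewrite (_ : N + N + (N + N) = (N + N + m) + (N + N - m))%N; last by lia.
  by apply: gbinom_stable; lia.
rewrite -(eqX_sum_tail (f := fun m => 'X^(theta_exp b a m.+1)) _ le_N2); last first.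
  by move=> i le_Ni; apply: eqX_Xn; rewrite /theta_exp; nia.
apply: eqX_sum => r _.
have [le_rN | lt_Nr] := leqP r.+1 N; last first.
  rewrite eqX_Xn ?mulr0; first exact: eqX_refl.
  by rewrite /theta_exp; nia.
rewrite mulrA -[X in eqX N _ X]mul1r; apply: eqXM; last exact: eqX_refl.
rewrite (_ : N + N + (N + N) = (N + N - r.+1) + (N + N + r.+1))%N; last by lia.
by apply: gbinom_stable; lia.
Qed.

End TripleProduct.

(** * Product identities modulo 2 *)

Lemma prod_dissect (R : comNzRingType) (d n : nat) (f : nat -> R) :
  \prod_(i < d * n) f i = \prod_(r < d) \prod_(j < n) f (d * j + r)%N.
Proof.
rewrite exchange_big /=; elim: n => [|n IHn]; first by rewrite muln0 !big_ord0.
by rewrite mulnSr big_split_ord big_ord_recr /= IHn.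
Qed.

Definition prod1X (N : nat) (f : nat -> nat) : {poly 'F_2} :=
  \prod_(j < N) (1 + 'X^(f j)).

Lemma pchar2_polyF2 : 2%N \in [pchar {poly 'F_2}].
Proof. by rewrite pchar_lalg pchar_Fp. Qed.

Section Mod2.

Variable N : nat.
Local Notation "p ≡ q" := (eqX N p q) (at level 70).

Lemma prod1X_coef0 f : (forall j, (0 < f j)%N) -> (prod1X N f)`_0 = 1.
Proof.
move=> f_gt0; rewrite -horner_coef0 horner_prod big1 // => i _.
by rewrite !hornerE expr0n -[(f i == 0)%N]negbK -lt0n f_gt0 addr0.
Qed.

(** Frobenius: [1 + X ^ (2 i) = (1 + X ^ i) ^ 2]. *)
Lemma prod1X_double f : prod1X N (fun j => 2 * f j)%N = prod1X N f ^+ 2.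
Proof.
rewrite -prodrXl; apply: eq_bigr => j _.
rewrite sqrrD expr1n mul1r -mulr_natr (pcharf0 pchar2_polyF2) mulr0 addr0.
by rewrite -exprM mulnC.
Qed.

(** An infinite product splits according to the residue of the index modulo
    [d].  The left side has [d * N] factors, of which those beyond the first [N]
    are 1 modulo ['X^N]. *)
Lemma prod1X_dissect d f :
  (0 < d)%N -> (forall i, (N <= i)%N -> (N <= f i)%N) ->
  \prod_(r < d) prod1X N (fun j => f (d * j + r)%N) ≡ prod1X N f.
Proof.
move=> d_gt0 f_ge; rewrite -(prod_dissect d N (fun i => 1 + 'X^(f i))).
apply: (eqX_prod_tail (f := fun i => 1 + 'X^(f i))); last by rewrite leq_pmull.
move=> i le_Ni; rewrite -[X in eqX N _ X]addr0; apply: eqXD => //.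
exact/eqX_Xn/f_ge.
Qed.

(** The mod 2 form of Euler's theorem on partitions into distinct and into odd
    parts: if [E] is the product over all exponents and [O] the one over odd
    exponents, splitting [E] by parity gives [E = O * E ^ 2], since the even
    exponents contribute [E ^ 2]. *)
Lemma odd_product_inverse c : (0 < c)%N ->
  prod1X N (fun j => c * (2 * j).+1)%N * prod1X N (fun j => c * j.+1)%N ≡ 1.
Proof.
move=> c_gt0; apply: (@eqX_mul2l _ _ (prod1X N (fun j => c * j.+1)%N)).
  by apply: prod1X_coef0 => j; rewrite muln_gt0 c_gt0.
have := @prod1X_dissect 2 (fun j => c * j.+1)%N isT.
rewrite !big_ord_recl big_ord0 /= mulr1.
set E := prod1X N (fun j => c * j.+1)%N.
set O := prod1X N (fun j => c * (2 * j).+1)%N.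
have -> : prod1X N (fun j => c * (2 * j + 0).+1)%N = O.
  by apply: eq_bigr => j _; rewrite addn0.
have -> : prod1X N (fun j => c * (2 * j + bump 0 0).+1)%N = E ^+ 2.
  rewrite -prod1X_double; apply: eq_bigr => j _; congr (1 + 'X^_).
  by rewrite /bump /=; nia.
rewrite mulr1 (_ : E * (O * E) = O * E ^+ 2); last by ring.
by apply=> i /=; nia.
Qed.

Lemma triple_product_mod2 a b : (0 < a)%N -> (0 < b)%N ->
  prod1X N (fun j => a + (a + b) * j)%N * prod1X N (fun j => b + (a + b) * j)%N
    * prod1X N (fun j => (a + b) * j.+1)%N ≡
  \sum_(m < N) 'X^(theta_exp a b m) + \sum_(r < N) 'X^(theta_exp b a r.+1).
Proof.
move=> a_gt0 b_gt0; have := @jacobi_triple_product 'F_2 a b a_gt0 b_gt0 N.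
congr (eqX N (_ * _) _); apply: eq_bigr => j _.
by rewrite (oppr_pchar2 pchar2_polyF2).
Qed.

(** The exponents of the first two products in the (3, 9) triple product are
    together the odd multiples of 3, and in characteristic 2 the third product is
    the fourth power of the product [E3] over all multiples of 3. *)
Lemma psi3_cube :
  \sum_(m < N) 'X^(theta_exp 3 9 m) + \sum_(r < N) 'X^(theta_exp 9 3 r.+1) ≡
  prod1X N (fun j => 3 * j.+1)%N ^+ 3.
Proof.
rewrite -(@triple_product_mod2 3 9) //.
set E3 := prod1X N (fun j => (3 * j.+1)%N).
have -> : prod1X N (fun j => ((3 + 9) * j.+1)%N) = E3 ^+ 4.
  rewrite (exprM _ 2 2) -!prod1X_double.
  by apply: eq_bigr => j _; congr (1 + 'X^_); rewrite ?/bump /=; lia.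
have := @prod1X_dissect 2 (fun j => 3 * (2 * j).+1)%N isT.
rewrite !big_ord_recl big_ord0 /= mulr1 => odd3.
have -> : prod1X N (fun j => (3 + (3 + 9) * j)%N) =
    prod1X N (fun j => (3 * (2 * (2 * j + 0)).+1)%N).
  by apply: eq_bigr => j _; congr (1 + 'X^_); rewrite ?/bump /=; lia.
have -> : prod1X N (fun j => (9 + (3 + 9) * j)%N) =
    prod1X N (fun j => (3 * (2 * (2 * j + bump 0 0)).+1)%N).
  by apply: eq_bigr => j _; congr (1 + 'X^_); rewrite ?/bump /=; lia.
rewrite odd3; last by move=> i /=; lia.
by rewrite exprS mulrA odd_product_inverse // mul1r.
Qed.

(** The exponents of the (1, 5) triple product are those odd numbers that are not
    odd multiples of 3, together with the multiples of 6. Inserting the factor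
    [O3 * E3 = 1], where [O3] is the product over the odd multiples of 3,
    completes the former to all odd exponents. *)
Lemma theta_times_euler :
  (\sum_(m < N) 'X^(theta_exp 1 5 m) + \sum_(r < N) 'X^(theta_exp 5 1 r.+1))
    * prod1X N succn ≡
  \sum_(m < N) 'X^(theta_exp 3 9 m) + \sum_(r < N) 'X^(theta_exp 9 3 r.+1).
Proof.
rewrite psi3_cube -(@triple_product_mod2 1 5) //.
set E3 := prod1X N (fun j => (3 * j.+1)%N); set E := prod1X N succn.
have -> : prod1X N (fun j => ((1 + 5) * j.+1)%N) = E3 ^+ 2.
  rewrite -!prod1X_double.
  by apply: eq_bigr => j _; congr (1 + 'X^_); rewrite ?/bump /=; lia.
have := @prod1X_dissect 3 (fun j => 1 * (2 * j).+1)%N isT.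
rewrite !big_ord_recl big_ord0 /= mulr1.
set A := prod1X N (fun j => (1 + _)%N); set B := prod1X N (fun j => (5 + _)%N).
have -> : prod1X N (fun j => (1 * (2 * (3 * j + 0)).+1)%N) = A.
  by apply: eq_bigr => j _; congr (1 + 'X^_); rewrite ?/bump /=; lia.
have -> : prod1X N (fun j => (1 * (2 * (3 * j + bump 0 (bump 0 0))).+1)%N) = B.
  by apply: eq_bigr => j _; congr (1 + 'X^_); rewrite /bump /=; lia.
set O3 := prod1X N _ => odd1.
have inv3 : O3 * E3 ≡ 1.
  rewrite -[X in eqX N _ X](@odd_product_inverse 3) //.
  rewrite (_ : O3 = prod1X N (fun j => (3 * (2 * j).+1)%N)) //.
  by apply: eq_bigr => j _; congr (1 + 'X^_); rewrite /bump /=; lia.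
have inv1 : A * (O3 * B) * E ≡ 1.
  rewrite odd1; last by move=> i /=; lia.
  rewrite -[X in eqX N _ X](@odd_product_inverse 1) //.
  apply: eqXM; first exact: eqX_refl.
  rewrite (_ : E = prod1X N (fun j => (1 * j.+1)%N)) //.
  by apply: eq_bigr => j _; rewrite mul1n.
rewrite -[X in eqX N X _]mulr1 -{1}inv3.
rewrite (_ : _ * _ = A * (O3 * B) * E * E3 ^+ 3); last by ring.
by rewrite inv1 mul1r.
Qed.

End Mod2.

(** * Partitions and their multiplicities *)

Lemma mem_leq_sumn (s : seq nat) x : x \in s -> (x <= sumn s)%N.
Proof. by move=> s_x; rewrite (perm_sumn (perm_to_rem s_x)) leq_addr. Qed.

Lemma sumn_by_mult K (s : seq nat) :
  {in s, forall x, (0 < x <= K)%N} ->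
  (\sum_(i < K) i.+1 * count_mem i.+1 s = sumn s)%N.
Proof.
elim: s => [|x s IHs] s_le /=.
  by rewrite big1 // => i _; rewrite muln0.
under eq_bigr do rewrite mulnDr.
rewrite big_split /= IHs; last by move=> y s_y; rewrite s_le // inE s_y orbT.
have /andP[x_gt0 x_le] : (0 < x <= K)%N by rewrite s_le // mem_head.
have x1K : (x.-1 < K)%N by rewrite prednK.
congr (_ + _)%N.
rewrite (bigD1 (Ordinal x1K)) //= prednK // eqxx muln1 big1 ?addn0 //.
move=> i ne_ix; rewrite [x == _](_ : _ = false) ?muln0 //; apply/negP => /eqP def_x.
by case/eqP: ne_ix; apply: val_inj; rewrite /= def_x.
Qed.

Section Multiplicity.

Variables (n K : nat).
Hypothesis le_nK : (n <= K)%N.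

(** The index [i] stands for the part [i.+1].  The number [K] of possible parts
    may exceed [n], so that a single [K] can serve for required parts that are
    too large to occur. *)
Definition multiplicity (l : n.-bseq 'I_n.+1) : {ffun 'I_K -> 'I_n.+1} :=
  [ffun i : 'I_K => inord (count_mem i.+1 (intpart_seq l))].

Lemma multiplicityE l i : multiplicity l i = count_mem i.+1 (intpart_seq l) :> nat.
Proof.
rewrite ffunE inordK // ltnS (leq_trans (count_size _ _)) //.
by rewrite size_map size_bseq.
Qed.

Lemma mem_intpart l x : l \in intparts n -> x \in intpart_seq l -> (0 < x <= K)%N.
Proof.
rewrite inE => /and3P[_ /allP l_gt0 /eqP sum_l] l_x.
by rewrite [(0 < x)%N]l_gt0 //= (leq_trans _ le_nK) // -sum_l mem_leq_sumn.
Qed.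

Lemma multiplicity_inj : {in intparts n &, injective multiplicity}.
Proof.
move=> l1 l2 part1 part2 eq_mult; apply: intpart_seq_inj.
have /and3P[sorted1 _ _] : is_intpart n (intpart_seq l1) by rewrite inE in part1.
have /and3P[sorted2 _ _] : is_intpart n (intpart_seq l2) by rewrite inE in part2.
apply: (sorted_eq (leT := geq)) => //.
- by move=> x y z /= le_xy le_zx; apply: leq_trans le_zx le_xy.
- by move=> x y /=; rewrite andbC; exact/anti_leq.
apply/allP => x /= s_x; apply/eqP.
have /andP[x_gt0 x_le] : (0 < x <= K)%N.
  by move: s_x; rewrite mem_cat => /orP[] /mem_intpart ->.
have x1K : (x.-1 < K)%N by rewrite prednK.
have /(congr1 val) := congr1 (fun f : {ffun _} => f (Ordinal x1K)) eq_mult.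
by rewrite /= !multiplicityE /= prednK.
Qed.

Lemma multiplicity_surj (f : {ffun 'I_K -> 'I_n.+1}) :
  (\sum_(i < K) i.+1 * f i)%N = n ->
  exists2 l, l \in intparts n & multiplicity l = f.
Proof.
move=> sum_f.
set t := flatten [seq nseq (f i) (val i).+1 | i <- enum 'I_K].
have part_s : is_intpart n (sort geq t).
  apply/and3P; split.
  - by apply: sort_sorted => x y; rewrite /geq /= leq_total.
  - by rewrite all_sort; apply/allP => x /flatten_mapP[i _ /nseqP[-> _]].
  - rewrite (perm_sumn (permEl (perm_sort _ _))) sumn_flatten -map_comp sumnE.
    rewrite big_map big_enum /= -[X in _ == X]sum_f; apply/eqP/eq_bigr => i _.
    by rewrite sumn_nseq.
have [l part_l def_l] := intpart_seqP _ _ part_s.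
exists l => //; apply/ffunP => i; apply: val_inj; rewrite /= multiplicityE def_l.
rewrite count_sort count_flatten -map_comp sumnE big_map big_enum /=.
rewrite (bigD1 i) //= count_nseq /= eqxx mul1n big1 ?addn0 // => j ne_ji.
by rewrite count_nseq /= eqSS (negbTE (_ : j != i :> nat)) ?mul0n.
Qed.

(** Expanding the product chooses a multiplicity for each part, which has to be
    positive when the part is required. *)
Lemma card_intparts_containing (F : fieldType) (S : pred nat) :
  #|[set l in intparts n |
      [forall i : 'I_K, S i ==> (i.+1 \in intpart_seq l)]]|%:R =
  (\prod_(i < K) \sum_(m < n.+1 | S i ==> (0 < m)%N) 'X^(i.+1 * m) : {poly F})`_n.
Proof.
rewrite bigA_distr_big_dep.
under eq_bigr do rewrite -expr_sum.
rewrite coef_sum; under eq_bigr do rewrite coefXn eq_sym.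
rewrite -natr_sum -big_mkcondr sum1dep_card; congr (_%:R).
rewrite -(card_in_imset (f := multiplicity)); last first.
  move=> l1 l2; rewrite !inE => /andP[part1 _] /andP[part2 _].
  by apply: multiplicity_inj; rewrite inE.
congr #|pred_of_set _|; apply/setP => f; rewrite inE.
have containing l : (multiplicity l \in family (fun (i : 'I_K) (m : 'I_n.+1) =>
      S i ==> (0 < m)%N)) = [forall i : 'I_K, S i ==> (i.+1 \in intpart_seq l)].
  by apply: eq_forallb => i; rewrite [LHS]inE multiplicityE -has_count has_pred1.
have mult_sum l : l \in intparts n -> (\sum_(i < K) i.+1 * multiplicity l i = n)%N.
  move=> part_l; under eq_bigr do rewrite multiplicityE.
  rewrite sumn_by_mult; last by move=> x; apply: mem_intpart.
  by move: part_l; rewrite inE => /and3P[_ _ /eqP].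
apply/imsetP/andP => [[l] | [fam_f /eqP /multiplicity_surj[l part_l def_f]]].
  by rewrite inE => /andP[part_l S_l] ->; rewrite containing S_l mult_sum.
by exists l; rewrite // inE part_l -containing def_f.
Qed.

End Multiplicity.

(** * The minimal excludant of multiples *)

(** A factor with [S i] is a geometric series without its constant term, which
    leaves ['X^(i.+1)] after multiplication by [1 - 'X^(i.+1)]. *)
Lemma prod_truncated_geometric (F : fieldType) (n K : nat) (S : pred nat) :
  eqX n.+1
    ((\prod_(i < K) \sum_(m < n.+1 | S i ==> (0 < m)%N) 'X^(i.+1 * m))
      * \prod_(i < K) (1 - 'X^(i.+1)))
    ('X^(\sum_(i < K | S i) i.+1) : {poly F}).
Proof.
rewrite expr_sum [X in eqX _ _ X]big_mkcond -big_split /=; apply: eqX_prod => i _.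
set y := 'X^(i.+1) : {poly F}.
have geom k : (\sum_(m < k) y ^+ m) * (1 - y) = 1 - y ^+ k.
  by rewrite mulrC -opprB mulNr -subrX1 opprB.
have y_high : eqX n.+1 (y ^+ n.+1) 0 by rewrite -exprM; apply: eqX_Xn; nia.
under eq_bigr do rewrite exprM.
have tail z : eqX n.+1 (z - y ^+ n.+1) z.
  by move: y_high; rewrite /eqX subr0 addrAC subrr sub0r dvdpNr.
case: ifP => Si /=; last by rewrite geom.
rewrite big_mkcond big_ord_recl /= add0r.
rewrite (eq_bigr (fun m : 'I_n => y * y ^+ m)) => [|m _]; last first.
  by rewrite /bump /= add1n exprS.
by rewrite -mulr_sumr -mulrA geom mulrBr mulr1 -exprS.
Qed.

Section MexOfMultiples.

Variables (A : nat) (A_gt0 : (0 < A)%N).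

Definition mex_rank (s : seq nat) : nat := mex A A A_gt0 s %/ A.

Lemma mex_rankE s : mex A A A_gt0 s = (A * mex_rank s)%N.
Proof.
rewrite mulnC divnK // /mex; case: ex_minnP => m /and3P[_ mA _] _.
by move: mA; rewrite modnn.
Qed.

Lemma mex_odd_rank s :
  (mex A A A_gt0 s == A %[mod 2 * A]) = odd (mex_rank s).
Proof.
rewrite mex_rankE -[X in _ == X %[mod _]]mul1n [(A * _)%N]mulnC -!muln_modl.
by rewrite eqn_pmul2r // modn2; case: odd.
Qed.

Lemma mem_lt_mex_rank s k : (0 < k < mex_rank s)%N -> (A * k)%N \in s.
Proof.
case/andP=> k_gt0 lt_k; have := mex_rankE s; rewrite /mex.
case: ex_minnP => m _ min_m def_m; apply: contraTT lt_k => s'k; rewrite -leqNgt.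
rewrite -(leq_pmul2l A_gt0) -def_m; apply: min_m.
by rewrite /mex_candidate muln_gt0 A_gt0 k_gt0 modnn modnMr eqxx.
Qed.

Lemma mex_rank_notin s : (0 < mex_rank s)%N /\ (A * mex_rank s)%N \notin s.
Proof.
have := mex_rankE s; rewrite /mex; case: ex_minnP => m /and3P[m_gt0 _ s'm] _ def_m.
by rewrite -def_m; split=> //; move: m_gt0; rewrite def_m muln_gt0 => /andP[].
Qed.

(** The parts [A, 2 A, .., j A], again with the index [i] standing for the part
    [i.+1]. *)
Definition multiple_upto (j : nat) : pred nat :=
  fun i => ((A %| i.+1) && (i.+1 <= A * j))%N.

Lemma contains_multiples K j s : (A * j <= K)%N ->
  [forall i : 'I_K, multiple_upto j i ==> (i.+1 \in s)] = (j < mex_rank s)%N.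
Proof.
move=> le_AjK; apply/forallP/idP => [all_s | lt_j i].
  have [rank_gt0 s'rank] := mex_rank_notin s.
  rewrite ltnNge; apply/negP => le_rank_j.
  have pred_eq : (A * mex_rank s).-1.+1 = (A * mex_rank s)%N.
    by rewrite prednK // muln_gt0 A_gt0.
  have lt_K : ((A * mex_rank s).-1 < K)%N.
    by rewrite pred_eq (leq_trans _ le_AjK) // leq_pmul2l.
  have := all_s (Ordinal lt_K); rewrite /multiple_upto /= pred_eq.
  by rewrite dvdn_mulr // leq_pmul2l // le_rank_j (negbTE s'rank).
apply/implyP => /andP[/dvdnP[k def_i] le_i]; move: (le_i); rewrite def_i mulnC.
rewrite leq_pmul2l // => le_kj; apply: mem_lt_mex_rank.
by rewrite (leq_ltn_trans le_kj lt_j) andbT lt0n; case: (k) def_i.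
Qed.

Lemma mex_rank_le n l : l \in intparts n -> (mex_rank (intpart_seq l) <= n.+1)%N.
Proof.
rewrite inE => /and3P[_ _ /eqP sum_l]; rewrite leqNgt; apply/negP => lt_n.
have /mem_leq_sumn : (A * n.+1)%N \in intpart_seq l by apply: mem_lt_mex_rank.
by rewrite sum_l; nia.
Qed.

(** The rank [k] of the excludant is the number of [j] such that
    [A, 2 A, .., j A] are all parts, and [k] is congruent modulo 2 to the
    indicator of [k] being odd; exchanging the sums over [j] and over the
    partitions gives the result. *)
Lemma mex_count_containing n K : (A * n <= K)%N ->
  (mex_count A A A_gt0 n)%:R = \sum_(j < n.+1)
    #|[set l in intparts n |
        [forall i : 'I_K, multiple_upto j i ==> (i.+1 \in intpart_seq l)]]|%:R
  :> 'F_2.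
Proof.
move=> le_K; rewrite -natr_sum.
have -> : (\sum_(j < n.+1) #|[set l in intparts n |
      [forall i : 'I_K, multiple_upto j i ==> (i.+1 \in intpart_seq l)]]| =
    \sum_(l in intparts n) mex_rank (intpart_seq l))%N.
  transitivity (\sum_(j < n.+1) \sum_(l in intparts n)
      (j < mex_rank (intpart_seq l)))%N.
    apply: eq_bigr => j _; rewrite -sum1dep_card big_mkcondr /=.
    apply: eq_bigr => l _; rewrite contains_multiples; first by case: ltnP.
    by rewrite (leq_trans _ le_K) // leq_pmul2l // -ltnS.
  rewrite exchange_big /=; apply: eq_bigr => l /mex_rank_le le_rank.
  transitivity (\sum_(j < n.+1 | j < mex_rank (intpart_seq l)) 1)%N.
    by rewrite [RHS]big_mkcond; apply: eq_bigr => j _; case: ltnP.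
  by rewrite -(big_ord_widen _ (fun=> 1%N)) // sum1_card card_ord.
have -> : mex_count A A A_gt0 n =
    (\sum_(l in intparts n) odd (mex_rank (intpart_seq l)))%N.
  rewrite /mex_count -sum1dep_card big_mkcondr /=.
  by apply: eq_bigr => l _; rewrite mex_odd_rank; case: odd.
rewrite !natr_sum; apply: eq_bigr => l _.
rewrite -[in RHS](odd_double_half (mex_rank _)) natrD -muln2 natrM.
by rewrite pchar_Fp_0 ?mulr0 ?addr0.
Qed.

Lemma multiple_upto_sum K j : (A * j <= K)%N ->
  (\sum_(i < K | multiple_upto j i) i.+1 = A * 'C(j.+1, 2))%N.
Proof.
elim: j => [|j IHj] le_K.
  by rewrite muln0 big_pred0 // => i; rewrite /multiple_upto muln0 andbF.
have pred_eq : (A * j.+1).-1.+1 = (A * j.+1)%N by rewrite prednK // muln_gt0 A_gt0.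
have lt_K : ((A * j.+1).-1 < K)%N by rewrite pred_eq.
rewrite (bigD1 (Ordinal lt_K)) /=; last first.
  by rewrite /multiple_upto pred_eq dvdn_mulr //=.
rewrite pred_eq [in RHS]binS bin1 mulnDr addnC -IHj; last first.
  by rewrite (leq_trans _ le_K) // leq_pmul2l.
congr (_ + _)%N; apply: eq_bigl => i; rewrite /multiple_upto -(inj_eq val_inj) /=.
rewrite -eqSS pred_eq; have [/dvdnP[k ->]|] //= := boolP (A %| i.+1)%N.
by rewrite [(k * A)%N]mulnC andbC -ltn_neqAle ltn_pmul2l // leq_pmul2l.
Qed.

Lemma mex_count_generating_function n :
  exists2 W : {poly 'F_2}, W`_n = (mex_count A A A_gt0 n)%:R &
    eqX n.+1 (W * \prod_(i < n.+1) (1 - 'X^(i.+1)))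
      (\sum_(j < n.+1) 'X^(A * 'C(j.+1, 2))).
Proof.
set K := (A * n.+1)%N; have le_K : (A * n <= K)%N by rewrite leq_pmul2l.
have le_nK : (n.+1 <= K)%N by rewrite leq_pmull.
exists (\sum_(j < n.+1) \prod_(i < K)
    \sum_(m < n.+1 | multiple_upto j i ==> (0 < m)%N) 'X^(i.+1 * m)).
  rewrite coef_sum (mex_count_containing le_K); apply: eq_bigr => j _.
  by rewrite -card_intparts_containing // ltnW.
rewrite -(eqX_prod_tail (f := fun i => 1 - 'X^(i.+1)) _ le_nK); last first.
  move=> i le_i; rewrite /eqX addrAC subrr sub0r dvdpNr.
  by rewrite dvdp_exp2l // ltnW.
rewrite mulr_suml; apply: eqX_sum => j _.
rewrite prod_truncated_geometric multiple_upto_sum //.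
by rewrite leq_pmul2l // ltnW.
Qed.

End MexOfMultiples.

(** * Comparison of the theta series *)

(** [3 T_j] with [j] odd is the exponent of a positive index of the (3, 9)
    theta series, and with [j > 0] even that of a negative one. *)
Lemma triangular_theta N :
  eqX N (\sum_(m < N) 'X^(theta_exp 3 9 m) + \sum_(r < N) 'X^(theta_exp 9 3 r.+1))
    (\sum_(j < N) 'X^(3 * 'C(j.+1, 2)) : {poly 'F_2}).
Proof.
have high k : (N <= k)%N -> eqX N ('X^(3 * 'C(k.+1, 2)) : {poly 'F_2}) 0.
  by move=> le_k; apply: eqX_Xn; rewrite binS bin1; lia.
(* The sums match exactly when the indices of the theta series are
   -N, .., N and j runs up to 2 N; index 0 corresponds to j = 0. *)
rewrite -(eqX_sum_tail (K := (2 * N).+1) high); last by lia.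
rewrite -(eqX_sum_tail (f := fun m => 'X^(theta_exp 3 9 m)) (K := N.+1)) //;
  last first.
  by move=> i le_Ni; apply: eqX_Xn; rewrite /theta_exp; lia.
set lhs := (X in eqX N X _); set rhs := (X in eqX N _ X).
suff -> : lhs = rhs by [].
rewrite {}/lhs {}/rhs {high}; elim: N => [|N IHN].
  by rewrite !big_ord1 big_ord0 addr0.
rewrite (big_ord_recr N.+1) [\sum_(r < N.+1) 'X^(theta_exp 9 3 _)]big_ord_recr /=.
rewrite addrACA IHN.
rewrite (_ : 2 * N.+1 = (2 * N).+2)%N; last by lia.
rewrite (big_ord_recr (2 * N).+2) (big_ord_recr (2 * N).+1) /= -addrA.
by congr (_ + ('X^_ + 'X^_)); have := bin2_double N.+1;
  have := bin2_double (2 * N).+2; have := bin2_double (2 * N).+3;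
  rewrite /theta_exp; nia.
Qed.

Lemma theta15_square m : (0 < m)%N -> (3 * theta_exp 1 5 m + 1 = (3 * m - 1) ^ 2)%N.
Proof.
case: m => // m _; have := bin2_double m.+1; rewrite /theta_exp mulnS -!mulnn.
by nia.
Qed.

Lemma theta51_square m : (3 * theta_exp 5 1 m + 1 = (3 * m + 1) ^ 2)%N.
Proof. by have := bin2_double m; rewrite /theta_exp -!mulnn; nia. Qed.

(** By [theta15_square] and [theta51_square], the terms of degree [n] are those
    of index [m >= 0] with [3 m - 1 = k] and those of index [- r < 0] with
    [3 r + 1 = k]; as [k] is prime to 3, it determines exactly one of them. *)
Lemma coef_theta_square n k : (0 < n)%N -> (3 * n + 1 = k ^ 2)%N ->
  (\sum_(m < n.+1) 'X^(theta_exp 1 5 m) +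
   \sum_(r < n.+1) 'X^(theta_exp 5 1 r.+1) : {poly 'F_2})`_n = 1.
Proof.
move=> n_gt0 def_n; rewrite coefD !coef_sum.
have eq15 m : (n == theta_exp 1 5 m) = (k.+1 == 3 * m)%N.
  case: (posnP m) => [->|m_gt0]; first
    by rewrite (_ : theta_exp 1 5 0 = 0%N) // muln0 gtn_eqF.
  rewrite -(eqn_pmul2l (_ : 0 < 3)%N) // -(eqn_add2r 1) def_n theta15_square //.
  by rewrite eqn_sqr; lia.
have eq51 r : (n == theta_exp 5 1 r) = (k == 3 * r + 1)%N.
  rewrite -(eqn_pmul2l (_ : 0 < 3)%N) // -(eqn_add2r 1) def_n theta51_square //.
  by rewrite eqn_sqr.
under eq_bigr do rewrite coefXn eq15.
under [X in _ + X]eq_bigr do rewrite coefXn eq51.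
have [t [[t_gt0 def_k] | def_k]] :
    exists t, (0 < t)%N /\ k = (3 * t + 1)%N \/ k = (3 * t + 2)%N.
  exists (k %/ 3)%N; have := divn_eq k 3; have : (k %% 3 < 3)%N by rewrite ltn_mod.
  by case: (k %% 3)%N => [|[|[|]]] // _ def_k; nia.
- have lt_t : (t.-1 < n.+1)%N by nia.
  rewrite big1 ?add0r => [|i _]; last by rewrite (_ : (_ == _) = false) //; lia.
  rewrite (bigD1 (Ordinal lt_t)) //= prednK // def_k eqxx big1 ?addr0 // => i.
  rewrite -(inj_eq val_inj) /= => ne_it.
  by rewrite (_ : (_ == _) = false) //; lia.
have lt_t : (t.+1 < n.+1)%N by nia.
rewrite addrC big1 ?add0r => [|i _]; last by rewrite (_ : (_ == _) = false) //; lia.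
rewrite (bigD1 (Ordinal lt_t)) //= (_ : (_ == _) = true); last by lia.
rewrite big1 ?addr0 // => i; rewrite -(inj_eq val_inj) /= => ne_it.
by rewrite (_ : (_ == _) = false) //; lia.
Qed.

Lemma coef_theta_nonsquare n : ~ perfect_square (3 * n + 1) ->
  (\sum_(m < n.+1) 'X^(theta_exp 1 5 m) +
   \sum_(r < n.+1) 'X^(theta_exp 5 1 r.+1) : {poly 'F_2})`_n = 0.
Proof.
move=> nsq; rewrite coefD !coef_sum !big1 ?addr0 // => i _; rewrite coefXn.
  case: eqP => // def_n; case: nsq.
  by exists (3 * i.+1 + 1)%N; rewrite {1}def_n theta51_square.
case: eqP => // def_n; case: nsq; case: (posnP i) => [i0|i_gt0].
  by exists 1%N; rewrite def_n i0.
by exists (3 * i - 1)%N; rewrite {1}def_n theta15_square.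
Qed.

Lemma mex_count_theta n :
  (mex_count 3 3 isT n)%:R =
  (\sum_(m < n.+1) 'X^(theta_exp 1 5 m) +
   \sum_(r < n.+1) 'X^(theta_exp 5 1 r.+1) : {poly 'F_2})`_n.
Proof.
have [W <- WE] := mex_count_generating_function (isT : (0 < 3)%N) n.
apply: (@eqX_coef _ n.+1) => //.
apply: (@eqX_mul2l _ _ (prod1X n.+1 succn)); first exact: prod1X_coef0.
rewrite ![prod1X _ _ * _]mulrC theta_times_euler triangular_theta -WE.
by apply: eqXM => //; apply: eqX_prod => i _; rewrite (oppr_pchar2 pchar2_polyF2).
Qed.

Lemma natr_F2_eq1 k : (k%:R == 1 :> 'F_2) = odd k.
Proof. by rewrite -[1]/(1%:R) -val_eqE /= !val_Fp_nat // !modn2; case: odd. Qed.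

Local Close Scope ring_scope.

Theorem theorem4 (n : nat) (n_gt0 : 1 <= n) :
  (perfect_square (3 * n + 1) ->
     mex_count 3 3 isT n = 1 %[mod 2]) /\
  (~ perfect_square (3 * n + 1) ->
     mex_count 3 3 isT n = 0 %[mod 2]).
Proof.
rewrite !modn2 -natr_F2_eq1 mex_count_theta; split=> [[k def_n] | nsq].
  by rewrite (coef_theta_square n_gt0 def_n).
by rewrite (coef_theta_nonsquare nsq).
Qed.
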